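(* Let $\phi\in\Gamma_0(\mathbb{R}^m)$ be Legendre and let $f:\mathbb{R}^m\to\overline{\mathbb{R}}$ be relatively amenable at $\bar x\in\operatorname{int}(\operatorname{dom}\phi)$ relative to $\phi$. Then $f$ is prox-regular relative to $\phi$ at $\bar x$.
   Context: $\overline{\mathbb{R}}=\mathbb{R}\cup\{-\infty,\infty\}$; $\Gamma_0(\mathbb{R}^m)$ is the set of proper lsc convex functions $\mathbb{R}^m\to\overline{\mathbb{R}}$. $\phi\in\Gamma_0(\mathbb{R}^m)$ is Legendre if it is essentially smooth ($\operatorname{int}(\operatorname{dom}\phi)\neq\emptyset$, $\phi$ is differentiable on $\operatorname{int}(\operatorname{dom}\phi)$, and $\|\nabla\phi(x^\nu)\|\to\infty$ whenever $x^\nu\to x\in\operatorname{bdry}\operatorname{dom}\phi$) and essentially strictly convex (strictly convex on every convex subset of $\operatorname{dom}\partial\phi$). Bregman distance: $D_\phi(x,y)=\phi(x)-\phi(y)-\langle\nabla\phi(y),x-y\rangle$ if $y\in\operatorname{int}(\operatorname{dom}\phi)$, $+\infty$ otherwise. $\partial f$ is the limiting (Mordukhovich) subdifferential. Smooth adaptable: a real function $h$ that is $\mathcal{C}^1$ on an open set $V\subseteq\operatorname{int}(\operatorname{dom}\phi)$ is $L$-smooth adaptable relative to $\phi$ on $V$, $L\ge0$, if both $L\phi-h$ and $L\phi+h$ are convex on $V$. A map $F$ into $\mathbb{R}^n$ that is $\mathcal{C}^1$ on $V$ is $L$-smooth adaptable relative to $\phi$ on $V$ if each coordinate function $F_i$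 is. Amenable: $f$ is amenable at $\bar x$, a point where $f(\bar x)$ is finite, if there is an open neighborhood $V\subset\mathbb{R}^m$ of $\bar x$ on which $f=g\circ F$ for a $\mathcal{C}^1$ mapping $F:V\to\mathbb{R}^n$ and a proper lsc convex function $g:\mathbb{R}^n\to\overline{\mathbb{R}}$ such that, with $D=\operatorname{cl}(\operatorname{dom}g)$, the only $y\in N_D(F(\bar x))$ with $\nabla F(\bar x)^*y=0$ is $y=0$ ($N_D$ denotes the normal cone, $\nabla F$ the Jacobian). $f$ is relatively amenable at $\bar x\in V$ relative to $\phi$ if in addition $V\subseteq\operatorname{int}(\operatorname{dom}\phi)$ and $F$ is $L$-smooth adaptable relative to $\phi$ on $V$ (for some $L\ge 0$). $f$ is locally lsc at $\bar x$ (where $f$ is finite) if there is $\epsilon>0$ such that all sets $\{x:\|x-\bar x\|\le\epsilon,\ f(x)\le\alpha\}$ with $\alpha\le f(\bar x)+\epsilon$ are closed. $f$ is prox-regular relative to $\phi$ at $\bar x\in\operatorname{int}(\operatorname{dom}\phi)$ for $\bar v$ if $f$ is finite and locally lsc at $\bar x$, $\bar v\in\partial f(\bar x)$, and there exist $\epsilon>0$, $r\ge0$ such that for all $\|x'-\bar x\|<\epsilon$, $\|x-\bar x\|<\epsilon$ (with $\epsilon$ sufficiently small that $x,x'\in\operatorname{int}(\operatorname{dom}\phi)$), $f(x')\ge f(x)+\langle v,x'-x\rangle-rD_\phi(x',x)$ whenever $f(x)-f(\bar x)<\epsilon$, $v\in\partial f(x)$, $\|v-\bar v\|<\epsilon$.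 If this holds for all $\bar v\in\partial f(\bar x)$, $f$ is prox-regular relative to $\phi$ at $\bar x$. *)

(* Defs.v *)
From HB Require Import structures.
From mathcomp Require Import all_boot all_order all_algebra.
From mathcomp Require Import all_classical all_reals all_analysis.

Set Implicit Arguments.
Unset Strict Implicit.
Unset Printing Implicit Defensive.

Import Order.TTheory GRing.Theory Num.Theory.
Import numFieldNormedType.Exports.

Local Open Scope classical_set_scope.
Local Open Scope ring_scope.

(* R^m is 'rV[R]_m. The library norm `|x| on 'rV[R]_m is the sup norm (which
   induces the usual topology); every norm below is the Euclidean one. *)

Definition dot (R : realType) (m : nat) (u v : 'rV[R]_m) : R :=
  \sum_i u 0 i * v 0 i.

Definition enorm (R : realType) (m : nat) (u : 'rV[R]_m) : R :=
  Num.sqrt (dot u u).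

Definition edom (R : realType) (m : nat) (f : 'rV[R]_m -> \bar R) :
    set 'rV[R]_m :=
  [set x | (f x < +oo)%E].

Definition proper_fun (R : realType) (m : nat) (f : 'rV[R]_m -> \bar R) : Prop :=
  edom f !=set0 /\ forall x, (-oo < f x)%E.

(* Only used for proper functions, so that the sum is never (+oo) + (-oo). *)
Definition econvex (R : realType) (m : nat) (f : 'rV[R]_m -> \bar R) : Prop :=
  forall (x y : 'rV[R]_m) (t : R), 0 < t -> t < 1 ->
    (f (t *: x + (1 - t) *: y)%R <= t%:E * f x + (1 - t)%:E * f y)%E.

Definition Gamma0 (R : realType) (m : nat) (f : 'rV[R]_m -> \bar R) : Prop :=
  [/\ proper_fun f, lower_semicontinuous f & econvex f].

(* v \in \hat\partial f(x): f(x') >= f(x) + <v, x' - x> + o(||x' - x||). *)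
Definition regular_subgradient (R : realType) (m : nat)
    (f : 'rV[R]_m -> \bar R) (x v : 'rV[R]_m) : Prop :=
  f x \is a fin_num /\
  forall e : R, 0 < e -> \forall x' \near x,
    (f x + (dot v (x' - x) - e * enorm (x' - x))%:E <= f x')%E.

(* The limiting (Mordukhovich) subdifferential. *)
Definition subdiff (R : realType) (m : nat)
    (f : 'rV[R]_m -> \bar R) (x : 'rV[R]_m) : set 'rV[R]_m :=
  [set v | f x \is a fin_num /\
    exists (xs vs : nat -> 'rV[R]_m),
      [/\ xs @ \oo --> x, f (xs k) @[k --> \oo] --> f x, vs @ \oo --> v
        & forall k, regular_subgradient f (xs k) (vs k)]].

Definition regular_normal (R : realType) (n : nat)
    (D : set 'rV[R]_n) (z v : 'rV[R]_n) : Prop :=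
  D z /\
  forall e : R, 0 < e -> \forall u \near z,
    D u -> dot v (u - z) <= e * enorm (u - z).

(* The limiting normal cone; for convex D it is the normal cone of convex
   analysis. *)
Definition normal_cone (R : realType) (n : nat)
    (D : set 'rV[R]_n) (z : 'rV[R]_n) : set 'rV[R]_n :=
  [set v | D z /\
    exists (zs vs : nat -> 'rV[R]_n),
      [/\ zs @ \oo --> z, vs @ \oo --> v
        & forall k, regular_normal D (zs k) (vs k)]].

(* Gradient of the real function fine \o phi; meaningful where phi is finite
   near x. *)
Definition grad (R : realType) (m : nat) (phi : 'rV[R]_m -> \bar R)
    (x : 'rV[R]_m) : 'rV[R]_m :=
  \row_i 'D_(delta_mx 0 i) (fine \o phi : 'rV[R]_m -> R^o) x.

Definition essentially_smooth (R : realType) (m : nat)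
    (phi : 'rV[R]_m -> \bar R) : Prop :=
  [/\ (edom phi)° !=set0,
      forall x, (edom phi)° x ->
        differentiable (fine \o phi : 'rV[R]_m -> R^o) x
    & forall (xs : nat -> 'rV[R]_m) (x : 'rV[R]_m),
        (forall k, (edom phi)° (xs k)) ->
        (closure (edom phi) `\` (edom phi)°) x ->
        xs @ \oo --> x ->
        enorm (grad phi (xs k)) @[k --> \oo] --> +oo].

Definition essentially_strictly_convex (R : realType) (m : nat)
    (phi : 'rV[R]_m -> \bar R) : Prop :=
  forall C : set 'rV[R]_m, convex_set C ->
    C `<=` [set x | subdiff phi x !=set0] ->
    forall (x y : 'rV[R]_m) (t : R), C x -> C y -> x != y -> 0 < t -> t < 1 ->
      (phi (t *: x + (1 - t) *: y)%R < t%:E * phi x + (1 - t)%:E * phi y)%E.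

Definition legendre (R : realType) (m : nat)
    (phi : 'rV[R]_m -> \bar R) : Prop :=
  essentially_smooth phi /\ essentially_strictly_convex phi.

Definition bregman (R : realType) (m : nat) (phi : 'rV[R]_m -> \bar R)
    (x y : 'rV[R]_m) : \bar R :=
  if `[< (edom phi)° y >]
  then (phi x - phi y - (dot (grad phi y) (x - y))%:E)%E
  else +oo%E.

(* V need not be convex: convexity on V is convexity on each convex subset. *)
Definition convex_on (R : realType) (m : nat) (V : set 'rV[R]_m)
    (h : 'rV[R]_m -> R) : Prop :=
  forall C : set 'rV[R]_m, convex_set C -> C `<=` V -> convex_function C h.

(* Used with V `<=` (edom phi)°, where fine (phi x) is the value of phi. *)
Definition smooth_adaptable (R : realType) (m : nat) (L : R)
    (phi : 'rV[R]_m -> \bar R) (V : set 'rV[R]_m) (h : 'rV[R]_m -> R) : Prop :=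
  convex_on V (fun x => L * fine (phi x) - h x) /\
  convex_on V (fun x => L * fine (phi x) + h x).

Definition C1_on (R : realType) (m n : nat) (V : set 'rV[R]_m)
    (F : 'rV[R]_m -> 'rV[R]_n) : Prop :=
  forall x, V x -> differentiable F x /\ {for x, continuous (jacobian F)}.

(* The library's jacobian F x acts on row vectors on the right,
   dF(x)(w) = w *m jacobian F x, so it is the transpose of the usual Jacobian
   matrix, and the row vector of \nabla F(x)^* y is y *m (jacobian F x)^T. *)
Definition amenable_rep (R : realType) (m n : nat) (f : 'rV[R]_m -> \bar R)
    (xbar : 'rV[R]_m) (V : set 'rV[R]_m) (F : 'rV[R]_m -> 'rV[R]_n)
    (g : 'rV[R]_n -> \bar R) : Prop :=
  [/\ open V /\ V xbar, C1_on V F, Gamma0 g, forall x, V x -> f x = g (F x)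
    & forall y, normal_cone (closure (edom g)) (F xbar) y ->
        y *m (jacobian F xbar)^T = 0 -> y = 0].

Definition relatively_amenable (R : realType) (m : nat)
    (phi f : 'rV[R]_m -> \bar R) (xbar : 'rV[R]_m) : Prop :=
  f xbar \is a fin_num /\
  exists (n : nat) (V : set 'rV[R]_m) (F : 'rV[R]_m -> 'rV[R]_n)
      (g : 'rV[R]_n -> \bar R),
    [/\ amenable_rep f xbar V F g, V `<=` (edom phi)°
      & exists2 L : R, 0 <= L &
          forall i, smooth_adaptable L phi V (fun x => F x 0 i)].

Definition locally_lsc (R : realType) (m : nat) (f : 'rV[R]_m -> \bar R)
    (xbar : 'rV[R]_m) : Prop :=
  exists2 e : R, 0 < e &
    forall alpha : R, (alpha%:E <= f xbar + e%:E)%E ->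
      closed [set x | enorm (x - xbar) <= e /\ (f x <= alpha%:E)%E].

Definition prox_regular_for (R : realType) (m : nat)
    (phi f : 'rV[R]_m -> \bar R) (xbar vbar : 'rV[R]_m) : Prop :=
  [/\ f xbar \is a fin_num, locally_lsc f xbar, subdiff f xbar vbar
    & exists e r : R, [/\ 0 < e, 0 <= r,
        forall x, enorm (x - xbar) < e -> (edom phi)° x
      & forall x' x v : 'rV[R]_m,
          enorm (x' - xbar) < e -> enorm (x - xbar) < e ->
          (f x - f xbar < e%:E)%E -> subdiff f x v -> enorm (v - vbar) < e ->
          (f x + (dot v (x' - x))%:E - r%:E * bregman phi x' x <= f x')%E]].

Definition prox_regular (R : realType) (m : nat)
    (phi f : 'rV[R]_m -> \bar R) (xbar : 'rV[R]_m) : Prop :=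
  forall vbar, subdiff f xbar vbar -> prox_regular_for phi f xbar vbar.

(* Main.v *)
Require Import Defs.
From HB Require Import structures.
From mathcomp Require Import all_boot all_order all_algebra.
From mathcomp Require Import all_classical all_reals all_analysis.
From mathcomp Require Import ring lra.

Set Implicit Arguments.
Unset Strict Implicit.
Unset Printing Implicit Defensive.

Import Order.TTheory GRing.Theory Num.Theory.
Import numFieldNormedType.Exports.

Local Open Scope classical_set_scope.
Local Open Scope ring_scope.

(** Write [f = g \o F] near [xbar], with [J] the Jacobian of [F].  The theorem
rests on an exact chain rule with uniformly bounded multipliers: for [x] near
[xbar] and [v] near [vbar], every limiting subgradient [v] of [f] at [x] is
[J(x)^* y] for some convex subgradient [y] of [g] at [F x] with [`|y| <= M].
Given this, convexity of [g] yields
[f x' = g (F x') >= f x + <y, F x' - F x>], and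
[<y, F x' - F x> = <v, x' - x> + <y, F x' - F x - dF(x)(x' - x)>].
Smooth adaptability bounds each coordinate of the linearization error by
[L * D_phi(x', x)] ([smooth_adaptable_linearization]), so [r = n * L * M] works.

The chain rule is obtained in three steps.

For a regular subgradient [v] of [f] at [x], the function
[g z - <v, x' - x> + d * `|x' - x| + k * |F x' - z|^2] of the pair [(x', z)] has,
for [k] large, a minimizer [(x1, z1)] close to [(x, F x)].  Stationarity in [z]
makes [y = 2 k (F x1 - z1)] a subgradient of [g] at [z1]; stationarity in [x']
gives [`|J(x1)^* y - v| <= d] ([fuzzy_chain_rule]).  A limiting subgradient is a
limit of regular ones, so it has the same approximate multipliers
([fuzzy_chain_rule_limiting]).

Approximate multipliers cannot blow up: a unit cluster direction of an unbounded
family would be a normal to the closed domain of [g] at [F xbar] annihilated by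
[J(xbar)^*], which the constraint qualification forbids ([multipliers_bounded]).

Being bounded, they have a cluster point, and lower semicontinuity of [g] makes
the graph of its subdifferential closed, so that the cluster point is an exact
multiplier ([limiting_chain_rule]).

Compactness is always used in its near-covering form: a property that holds
locally around each point of a compact set, for parameters eventually along a
filter, holds on the whole set eventually along that filter.  Here the parameters
are the nearby base points, and possibly a real number tending to infinity. *)

(** * Inner product, sup norm and Euclidean norm *)

Section EuclideanBasics.
Context {R : realType}.
Implicit Types m n : nat.

Lemma dotC m (u v : 'rV[R]_m) : dot u v = dot v u.
Proof. by apply: eq_bigr => i _; rewrite mulrC. Qed.

Lemma dotDl m (u v w : 'rV[R]_m) : dot (u + v) w = dot u w + dot v w.
Proof. by rewrite -big_split; apply: eq_bigr => i _; rewrite !mxE mulrDl. Qed.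

Lemma dotZl m (a : R) (u w : 'rV[R]_m) : dot (a *: u) w = a * dot u w.
Proof. by rewrite [RHS]mulr_sumr; apply: eq_bigr => i _; rewrite !mxE mulrA. Qed.

Lemma dotBl m (u v w : 'rV[R]_m) : dot (u - v) w = dot u w - dot v w.
Proof. by rewrite dotDl -scaleN1r dotZl mulN1r. Qed.

Lemma dotDr m (u v w : 'rV[R]_m) : dot w (u + v) = dot w u + dot w v.
Proof. by rewrite !(dotC w) dotDl. Qed.

Lemma dotBr m (u v w : 'rV[R]_m) : dot w (u - v) = dot w u - dot w v.
Proof. by rewrite !(dotC w) dotBl. Qed.

Lemma dotZr m (a : R) (u w : 'rV[R]_m) : dot u (a *: w) = a * dot u w.
Proof. by rewrite !(dotC u) dotZl. Qed.

Lemma dot0l m (u : 'rV[R]_m) : dot 0 u = 0.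
Proof. by rewrite -(scale0r 0) dotZl mul0r. Qed.

Lemma dot0r m (u : 'rV[R]_m) : dot u 0 = 0.
Proof. by rewrite dotC dot0l. Qed.

Lemma dot_ge0 m (u : 'rV[R]_m) : 0 <= dot u u.
Proof. by apply: sumr_ge0 => i _; rewrite -expr2 sqr_ge0. Qed.

Lemma dot_eq0 m (u : 'rV[R]_m) : dot u u = 0 -> u = 0.
Proof.
move=> /eqP; rewrite psumr_eq0; last by move=> i _; rewrite -expr2 sqr_ge0.
move=> /allP u0; apply/rowP => i; rewrite mxE; apply/eqP.
by have := u0 i (mem_index_enum i); rewrite /= mulf_eq0 orbb.
Qed.

Lemma dot_mulmx_tr m n (y : 'rV[R]_n) (A : 'M[R]_(m, n)) (w : 'rV[R]_m) :
  dot (y *m A^T) w = dot y (w *m A).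
Proof.
have dotE k (u v : 'rV[R]_k) : dot u v = (u *m v^T) 0 0.
  by rewrite mxE; apply: eq_bigr => i _; rewrite mxE.
by rewrite !dotE trmx_mul mulmxA.
Qed.

Lemma rV_norm_leP m (u : 'rV[R]_m) (c : R) : 0 <= c ->
  `|u| <= c <-> forall i, `|u 0 i| <= c.
Proof.
move=> c0; rewrite /Num.norm/= mx_normrE; split.
  by move=> /bigmax_leP[_ uc] i; exact: (uc (0, i)).
by move=> uc; apply: (bigmax_le _ c0) => -[j i] _ /=; rewrite (ord1 j); exact: uc.
Qed.

Lemma coord_le_norm m (u : 'rV[R]_m) i : `|u 0 i| <= `|u|.
Proof. by move: i; apply/rV_norm_leP. Qed.

(** The dual of the sup norm is the sum norm, which dominates the sup norm; it
suffices to test against the signed basis vectors. *)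
Lemma norm_le_dual m (u : 'rV[R]_m) (c : R) : 0 <= c ->
  (forall w, dot u w <= c * `|w|) -> `|u| <= c.
Proof.
move=> c0 uc; apply/rV_norm_leP => // i.
have dotd (s : R) : dot u (s *: delta_mx 0 i) = s * u 0 i.
  rewrite dotZr /dot (bigD1 i)//= big1 ?addr0 => [|j ji].
    by rewrite mxE !eqxx mulr1.
  by rewrite mxE (negbTE ji) andbF mulr0.
have dn : `|delta_mx 0 i : 'rV[R]_m| <= 1.
  by apply/rV_norm_leP => // j; rewrite mxE eqxx/=; case: eqP; rewrite ?normr1 ?normr0.
have step s : `|s| = 1 -> s * u 0 i <= c.
  move=> s1; rewrite -dotd (le_trans (uc _))// normrZ s1 mul1r.
  by rewrite ler_piMr.
rewrite ler_norml -[in X in X <= c](mul1r (u 0 i)) step ?normr1// andbT.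
by rewrite lerNl -mulN1r step// normrN1.
Qed.

Lemma enorm_ge0 m (u : 'rV[R]_m) : 0 <= enorm u.
Proof. exact: sqrtr_ge0. Qed.

Lemma norm_le_enorm m (u : 'rV[R]_m) : `|u| <= enorm u.
Proof.
apply/rV_norm_leP => [|i]; first exact: enorm_ge0.
rewrite -sqrtr_sqr ler_sqrt ?dot_ge0// /dot (bigD1 i)//= -expr2 lerDl.
by apply: sumr_ge0 => j _; rewrite -expr2 sqr_ge0.
Qed.

Lemma enorm_le_norm m (u : 'rV[R]_m) : enorm u <= m.+1%:R * `|u|.
Proof.
rewrite -[leRHS]ger0_norm ?mulr_ge0// -sqrtr_sqr ler_sqrt ?sqr_ge0//.
have : dot u u <= \sum_(i < m) `|u| ^+ 2.
  apply: ler_sum => i _; rewrite -expr2 -(real_normK (num_real (u 0 i))).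
  by rewrite lerXn2r ?nnegrE// coord_le_norm.
move=> /le_trans; apply; rewrite sumr_const card_ord -[leLHS]mulr_natl exprMn.
rewrite ler_wpM2r ?sqr_ge0// -natrX ler_nat.
by rewrite (leq_trans (leqnSn _))// leq_pmulr.
Qed.

End EuclideanBasics.

(** * Limits of vector and matrix expressions *)

Section Continuity.
Context {R : realType} {T : Type} {G : set_system T} {FG : Filter G}.

Lemma cvg_mx m n (A : T -> 'M[R]_(m, n)) (B : 'M[R]_(m, n)) :
  (forall i j, A t i j @[t --> G] --> B i j) -> A @ G --> B.
Proof.
move=> AB S [P BP PS]; rewrite /nbhs/=.
have : \forall t \near G, forall i j, P i j (A t i j).
  by apply: filter_forall => i; apply: filter_forall => j; apply: AB.
by apply: filterS => t At; apply: PS.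
Qed.

Lemma cvg_entry m n (A : T -> 'M[R]_(m, n)) (B : 'M[R]_(m, n)) i j :
  A @ G --> B -> A t i j @[t --> G] --> B i j.
Proof. by move=> AB; exact: (continuous_cvg _ (@coord_continuous _ _ _ i j B) AB). Qed.

Lemma cvg_sum_ord n (a : 'I_n -> T -> R) (b : 'I_n -> R) :
  (forall i, a i @ G --> b i) -> \sum_i a i t @[t --> G] --> \sum_i b i.
Proof. by move=> ab; apply: cvg_big => // x; exact: add_continuous. Qed.

Lemma cvg_dot m (u v : T -> 'rV[R]_m) (a b : 'rV[R]_m) :
  u @ G --> a -> v @ G --> b -> dot (u t) (v t) @[t --> G] --> dot a b.
Proof.
by move=> ua vb; apply: cvg_sum_ord => i; apply: cvgM; exact: cvg_entry.
Qed.

Lemma cvg_mulmx_tr m n (y : T -> 'rV[R]_n) (A : T -> 'M[R]_(m, n))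
    (y0 : 'rV[R]_n) (A0 : 'M[R]_(m, n)) :
  y @ G --> y0 -> A @ G --> A0 -> y t *m (A t)^T @[t --> G] --> y0 *m A0^T.
Proof.
move=> yy AA; apply: cvg_mx => i j; rewrite mxE.
have -> : (fun t => (y t *m (A t)^T) i j) =
    (fun t => \sum_k y t i k * A t j k).
  by apply: funext => t; rewrite mxE; under eq_bigr do rewrite mxE.
apply: cvg_sum_ord => k; rewrite mxE.
by apply: cvgM; exact: cvg_entry.
Qed.

Lemma cvg_dist m n (A : T -> 'M[R]_(m, n)) (B C : 'M[R]_(m, n)) :
  A @ G --> B -> `|A t - C| @[t --> G] --> `|B - C|.
Proof. by move=> AB; exact: cvg_norm (cvgB AB (cvg_cst C)). Qed.

Lemma cvg_enorm m (u : T -> 'rV[R]_m) (a : 'rV[R]_m) :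
  u @ G --> a -> enorm (u t) @[t --> G] --> enorm a.
Proof.
by move=> ua; exact: (continuous_cvg _ (@sqrt_continuous R (dot a a)) (cvg_dot ua ua)).
Qed.

End Continuity.

Lemma compact_sup_ball {R : realType} n (x : 'rV[R]_n) (r : R) :
  compact [set y | `|y - x| <= r].
Proof.
apply: bounded_closed_compact.
  exists (r + `|x|); split; first exact: num_real.
  move=> M rM y /= yx; rewrite (le_trans _ (ltW rM))//.
  by rewrite -(subrK x y) (le_trans (ler_normD _ _))// lerD2r.
have cn : continuous (fun y : 'rV[R]_n => `|y - x|).
  by move=> y; exact: (cvg_dist (@cvg_id _ (nbhs y))).
by move/continuous_closedP : cn => /(_ _ (@closed_le R r)).
Qed.

(** * Lower semicontinuity, minima on compact sets, penalties *)

Section LowerSemicontinuity.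
Context {R : realType}.
Local Open Scope ereal_scope.

(** A pointwise notion is needed because the penalized function below involves
[F], which is continuous only on an open set. *)
Definition lsc_at {T : topologicalType} (f : T -> \bar R) (p : T) : Prop :=
  forall c : R, c%:E < f p -> \forall q \near p, c%:E < f q.

Lemma lower_semicontinuous_at (T : topologicalType) (f : T -> \bar R) p :
  lower_semicontinuous f -> lsc_at f p.
Proof. by move=> flsc c /flsc[V Vp Vf]; exact: filterS Vp. Qed.

Lemma lsc_at_comp (S T : topologicalType) (g : T -> \bar R) (u : S -> T) p :
  {for p, continuous u} -> lsc_at g (u p) -> lsc_at (g \o u) p.
Proof. by move=> uc glsc c /glsc /uc. Qed.

Lemma exists_fin_between (b x : \bar R) : -oo < x -> b < x ->
  exists d : R, b <= d%:E < x.
Proof.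
case: b => [b|//|] x0 bx; first by exists b; rewrite lexx bx.
  by move: bx; rewrite ltNge leey.
case: x x0 {bx} => [x _|_|]; last by rewrite ltxx.
  by exists (x - 1)%R; rewrite leNye lte_fin ltrBlDr ltrDl ltr01.
by exists 0%R; rewrite leNye ltry.
Qed.

Lemma lsc_at_addr (T : topologicalType) (f : T -> \bar R) (h : T -> R) p :
  lsc_at f p -> {for p, continuous h} ->
  lsc_at (fun q => f q + (h q)%:E) p.
Proof.
move=> flsc hc c cfh.
have cf : (c - h p)%:E < f p by rewrite EFinB lteBlDr.
have fp : -oo < f p by apply: lt_trans cf; rewrite ltNyr.
(* Split the slack in [c < f p + h p] between the two summands. *)
have [d [cd df]] : exists d : R, (c - h p < d)%R /\ d%:E < f p.
  case: (f p) cf => [a|_|//]; last by exists (c - h p + 1)%R; rewrite ltrDl ltry.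
  rewrite lte_fin => ca; exists ((c - h p + a) / 2)%R.
  by rewrite lte_fin midf_lt// midf_lt.
have hq : \forall q \near p, (c - d < h q)%R.
  by apply: (cvgr_gt (h p)) => //; rewrite ltrBlDl -ltrBlDr.
near=> q.
have : d%:E < f q by near: q; exact: flsc.
have : (c - d < h q)%R by near: q.
rewrite -lte_fin EFinB => h1 h2.
by rewrite -(subrK d c) EFinD addeC lteD.
Unshelve. all: by end_near. Qed.

(** The sublevel sets of [f] in [K] at its own values form a filter base.  Were
there no minimizer, each point of [K] would have a neighbourhood on which [f]
exceeds some value [f q]; the near-covering property would then give a single
[q] in [K] with [f q < f p] for all [p] in [K], absurd for [p = q]. *)
Lemma lsc_compact_min (T : topologicalType) (K : set T) (f : T -> \bar R) :
  compact K -> K !=set0 -> (forall p, K p -> -oo < f p) ->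
  (forall p, K p -> lsc_at f p) ->
  exists2 p, K p & forall q, K q -> f p <= f q.
Proof.
move=> cK [p0 Kp0] fNy flsc; apply: contrapT => nomin.
have lower p : K p -> exists2 q, K q & f q < f p.
  move=> Kp; apply: contrapT => noq; apply: nomin; exists p => // q Kq.
  by rewrite leNgt; apply/negP => qp; apply: noq; exists q.
pose B q := [set r | K r /\ f r <= f q].
pose FB := filter_from K B.
have FF : Filter FB.
  apply: filter_from_filter; first by exists p0.
  move=> a b Ka Kb; have [ab|/ltW ba] := leP (f a) (f b).
    by exists a => // r [Kr ra]; split; split => //; exact: le_trans ra ab.
  by exists b => // r [Kr ra]; split; split => //; exact: le_trans ra ba.
move/compact_near_coveringP : cK => /(_ _ FB (fun r p => f r < f p) FF) [].
- move=> p Kp; have [q Kq qp] := lower _ Kp.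
  have [d /andP[qd dp]] := exists_fin_between (fNy _ Kp) qp.
  near=> p' r => /=; apply: (@le_lt_trans _ _ (f q)).
    suff : B q r by case.
    by near: r; exists q.
  apply: (le_lt_trans qd).
  by near: p'; exact: flsc.
- move=> q Kq /(_ q) Bq; have /Bq : B q q by split.
  by move=> /(_ q Kq); rewrite ltxx.
Unshelve. all: by end_near. Qed.

(** Where the penalized quantity vanishes, the bound holds already without
penalty, and semicontinuity extends it to a neighbourhood; elsewhere the
penalty is bounded away from zero and wins for large parameters. *)
Lemma penalty_eventually_exceeds (T : topologicalType) (f : T -> \bar R)
    (q : T -> R) (a : R) (p : T) :
  -oo < f p -> lsc_at f p -> {for p, continuous q} ->
  (forall p', (0 <= q p')%R) -> (q p = 0%R -> a%:E < f p) ->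
  \forall p' \near p & k \near +oo%R, a%:E < f p' + (k * q p')%:E.
Proof.
move=> fp flsc qc q0 qf; have [qp0|qp0] := eqVneq (q p) 0%R.
  near=> p' k => /=.
  have fp' : a%:E < f p' by near: p'; exact/flsc/qf.
  by rewrite (lt_le_trans fp')// leeDl// lee_fin mulr_ge0.
have qp : (0 < q p)%R by rewrite lt_neqAle eq_sym qp0 q0.
have [c /andP[_ cf]] := exists_fin_between fp fp.
near=> p' k => /=.
have fp' : c%:E < f p' by near: p'; exact: flsc.
have qp' : (q p / 2 < q p')%R.
  by near: p'; apply: (cvgr_gt (q p)) => //; lra.
have k0 : (0 <= k)%R by [].
have kc : ((a - c) / (q p / 2) < k)%R by near: k; apply: nbhs_pinfty_gt; exact: num_real.
rewrite -(subrK c a) EFinD addeC lte_leD// lee_fin.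
rewrite ltr_pdivrMr ?divr_gt0// in kc.
by rewrite (le_trans (ltW kc))// ler_wpM2l// ltW.
Unshelve. all: by end_near. Qed.

End LowerSemicontinuity.

(** * First-order conditions for the penalized problem *)

Section ConvexSubgradients.
Context {R : realType}.
Implicit Types n : nat.

Definition convex_subgradient n (g : 'rV[R]_n -> \bar R) (z y : 'rV[R]_n) :
    Prop :=
  forall z', (g z + (dot y (z' - z))%:E <= g z')%E.

Lemma ler0_of_linear_bound (s C : R) :
  (\forall t \near 0^'+, s <= t * C) -> s <= 0.
Proof.
move=> sC; have tC : t * C @[t --> 0^'+] --> (0 * C : R).
  by exact: cvgM (cvg_at_right_filter cvg_id) (cvg_cst C).
by rewrite -(mul0r C); exact: cvgr_to_ge tC sC.
Qed.

Lemma dot_subZ_sqr n (c u : 'rV[R]_n) (t : R) :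
  dot (c - t *: u) (c - t *: u) =
  dot c c - 2 * t * dot c u + t ^+ 2 * dot u u.
Proof. by rewrite !(dotBl, dotBr, dotZl, dotZr) (dotC u c); ring. Qed.

Lemma cvg_line n (a b : 'rV[R]_n) : t *: a + b @[t --> 0^'+] --> b.
Proof.
suff : t *: a + b @[t --> 0^'+] --> 0 *: a + b by rewrite scale0r add0r.
apply: cvgD; last exact: cvg_cst.
by apply: cvgZr_tmp; exact: cvg_at_right_filter cvg_id.
Qed.

(** A local minimizer of [g] plus a quadratic satisfies the global subgradient
inequality: compare [z] with the points [z + t (z' - z)], bound [g] there by
convexity, divide by [t] and let [t] tend to zero, where the second-order term of
the quadratic vanishes. *)
Lemma convex_subgradient_of_prox_min n (g : 'rV[R]_n -> \bar R)
    (z w : 'rV[R]_n) (k : R) :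
  proper_fun g -> econvex g -> g z \is a fin_num ->
  (\forall z' \near z, (g z + (k * dot (w - z) (w - z))%:E <=
                        g z' + (k * dot (w - z') (w - z'))%:E)%E) ->
  convex_subgradient g z ((2 * k) *: (w - z)).
Proof.
move=> [_ gNy] gconv gzfin zmin z'.
have [->|gz'] := eqVneq (g z') +oo%E; first by rewrite leey.
have gz'fin : g z' \is a fin_num by rewrite fin_real// gNy ltey gz'.
rewrite -(fineK gzfin) -(fineK gz'fin) -EFinD lee_fin dotZl -subr_le0.
set a := fine (g z); set b := fine (g z'); set u := z' - z.
apply: (@ler0_of_linear_bound _ (k * dot u u)).
have zt : t *: u + z @[t --> 0^'+] --> z by exact: cvg_line.
near=> t.
have t0 : 0 < t by near: t; exact: nbhs_right_gt.
have t1 : t < 1 by near: t; exact: nbhs_right_lt.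
have : (g z + (k * dot (w - z) (w - z))%:E <=
        g (t *: u + z)%R + (k * dot (w - (t *: u + z)) (w - (t *: u + z)))%:E)%E.
  by near: t; exact: (zt _ zmin).
have := gconv z' z t t0 t1.
have -> : t *: z' + (1 - t) *: z = t *: u + z.
  by rewrite /u scalerBr scalerBl scale1r addrA addrAC.
rewrite -(fineK gzfin) -(fineK gz'fin) -/a -/b => gt1 gt2.
have := le_trans gt2 (leeD2r _ gt1).
have -> : w - (t *: u + z) = (w - z) - t *: u by rewrite opprD addrA addrAC.
rewrite -!EFinM -!EFinD lee_fin dot_subZ_sqr => gt3.
by rewrite -(ler_pM2l t0); lra.
Unshelve. all: by end_near. Qed.

(** The term [d * `|x' - x|] is not differentiable at [x], which may be the
minimizer itself.  By the triangle inequality it varies by at most [d * t * `|w|]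
along a step [t *: w], so the one-sided derivative of the smooth part in every
direction [w] is at least [- d * `|w|], and this bounds its gradient by [d]. *)
Lemma stationary_of_penalty_min m n (F : 'rV[R]_m -> 'rV[R]_n)
    (x x1 v : 'rV[R]_m) (z : 'rV[R]_n) (d k : R) :
  differentiable F x1 -> 0 <= d ->
  (\forall x' \near x1,
     d * `|x1 - x| - dot v (x1 - x) + k * dot (F x1 - z) (F x1 - z) <=
     d * `|x' - x| - dot v (x' - x) + k * dot (F x' - z) (F x' - z)) ->
  `|((2 * k) *: (F x1 - z)) *m (jacobian F x1)^T - v| <= d.
Proof.
move=> dF d0 xmin; rewrite distrC; apply: norm_le_dual => // w.
rewrite dotBl dot_mulmx_tr dotZl.
pose q t := t^-1 *: (F (t *: w + x1) - F x1).
have xt : t *: w + x1 @[t --> 0^'+] --> x1 by exact: cvg_line.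
have qJ : q t @[t --> 0^'+] --> w *m jacobian F x1.
  rewrite -deriveEjacobian//; apply: cvg_dnbhs_at_right.
  exact: diff_derivable.
pose r t := d * `|w| - dot v w +
  k * dot (q t) ((F (t *: w + x1) - z) + (F x1 - z)).
have rl : r t @[t --> 0^'+] --> d * `|w| - dot v w +
    k * dot (w *m jacobian F x1) ((F x1 - z) + (F x1 - z)).
  apply: cvgD; first exact: cvg_cst.
  apply: cvgM; first exact: cvg_cst.
  apply: cvg_dot => //; apply: cvgD; last exact: cvg_cst.
  apply: cvgB; last exact: cvg_cst.
  exact: (continuous_cvg _ (differentiable_continuous dF) xt).
(* [t * r t] bounds from above the increase of the objective along [t *: w]:
   factor the difference of the two squares. *)
suff r0 : \forall t \near 0^'+, 0 <= r t.
  by have /(_ _) := cvgr_to_ge rl r0; rewrite dotDr (dotC (w *m _)); lra.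
near=> t.
have t0 : 0 < t by near: t; exact: nbhs_right_gt.
have : d * `|x1 - x| - dot v (x1 - x) + k * dot (F x1 - z) (F x1 - z) <=
    d * `|t *: w + x1 - x| - dot v (t *: w + x1 - x) +
    k * dot (F (t *: w + x1) - z) (F (t *: w + x1) - z).
  by near: t; exact: (xt _ xmin).
have : d * `|t *: w + x1 - x| <= d * (t * `|w| + `|x1 - x|).
  rewrite ler_wpM2l// -addrA (le_trans (ler_normD _ _))//.
  by rewrite normrZ (gtr0_norm t0).
have -> : dot v (t *: w + x1 - x) = t * dot v w + dot v (x1 - x).
  by rewrite -addrA (dotDr (t *: w)) dotZr.
move=> le1 le2.
rewrite -(pmulr_rge0 _ t0) /r mulrDr (mulrCA t) -dotZl scalerA mulfV ?gt_eqF//.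
rewrite scale1r.
have -> : dot (F (t *: w + x1) - F x1) (F (t *: w + x1) - z + (F x1 - z)) =
    dot (F (t *: w + x1) - z) (F (t *: w + x1) - z) -
    dot (F x1 - z) (F x1 - z).
  rewrite !(dotBl, dotBr, dotDr) (dotC z) (dotC z) (dotC (F x1) (F (t *: w + x1))); ring.
lra.
Unshelve. all: by end_near. Qed.

End ConvexSubgradients.

(** * Approximate chain rule for regular subgradients *)

Section FuzzyChainRule.
Context {R : realType} {m n : nat}.
Implicit Types (f : 'rV[R]_m -> \bar R) (g : 'rV[R]_n -> \bar R).
Implicit Types (F : 'rV[R]_m -> 'rV[R]_n) (V : set 'rV[R]_m).

Lemma regular_subgradient_sup_norm f x v (e : R) :
  regular_subgradient f x v -> 0 < e -> \forall x' \near x,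
    (f x + (dot v (x' - x) - e * `|x' - x|)%:E <= f x')%E.
Proof.
move=> [_ vreg] e0; have m0 : 0 < m.+1%:R :> R by rewrite ltr0n.
have := vreg _ (divr_gt0 e0 m0); apply: filterS => x'; apply: le_trans.
rewrite leeD2l// lee_fin lerD2l lerN2 -mulrA ler_wpM2l ?(ltW e0)//.
by rewrite ler_pdivrMl// enorm_le_norm.
Qed.

(** Penalize the constraint [z = F x'] and minimize over the product of two small
closed balls.  Where the constraint holds and [x' != x], the objective exceeds
[f x] because the slope [d] is twice the error rate granted by the regular
subgradient; where it fails, a large penalty makes the objective exceed [f x].
As the value at [(x, F x)] is [f x], the minimizer lies in the interior of both
balls, and the two first-order conditions apply. *)
Lemma fuzzy_chain_rule f g F V (x v : 'rV[R]_m) (d : R) :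
  open V -> V x -> (forall x', V x' -> differentiable F x') ->
  Gamma0 g -> (forall x', V x' -> f x' = g (F x')) ->
  regular_subgradient f x v -> 0 < d ->
  exists x1 z1 y, [/\ `|x1 - x| < d, `|z1 - F x| < d, V x1,
    convex_subgradient g z1 y & `|y *m (jacobian F x1)^T - v| <= d].
Proof.
move=> oV Vx dF [gp glsc gconv] fg vreg d0.
have fxfin : f x \is a fin_num by case: vreg.
have d20 : 0 < d / 2 by rewrite divr_gt0.
have : \forall x' \near x, V x' /\
    (f x + (dot v (x' - x) - d / 2 * `|x' - x|)%:E <= f x')%E.
  apply: filterI; first exact: open_nbhs_nbhs.
  exact: regular_subgradient_sup_norm.
move=> /nbhs_ballP[r0 /= r00 xr0].
pose r := Num.min (r0 / 2) (d / 2).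
have r_gt0 : 0 < r by rewrite lt_min !divr_gt0.
have rd : r < d by rewrite gt_min [X in _ || X]ltr_pdivrMr// ltr_pMr// ltr1n orbT.
have rr0 : r < r0 by rewrite gt_min ltr_pdivrMr// ltr_pMr// ltr1n.
have {}xr0 x' : `|x' - x| <= r -> V x' /\
    (f x + (dot v (x' - x) - d / 2 * `|x' - x|)%:E <= f x')%E.
  move=> x'r; apply: xr0; rewrite -ball_normE/= distrC.
  exact: le_lt_trans x'r rr0.
pose K := [set x' | `|x' - x| <= r] `*` [set z | `|z - F x| <= r].
have cK : compact K by apply: compact_setX; exact: compact_sup_ball.
pose h x' := d * `|x' - x| - dot v (x' - x).
pose f0 p := (g p.2 + (h p.1)%:E)%E.
pose q p := dot (F p.1 - p.2) (F p.1 - p.2).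
have fstc (p : 'rV[R]_m * 'rV[R]_n) : fst @ p --> p.1 by exact: cvg_fst.
have sndc (p : 'rV[R]_m * 'rV[R]_n) : snd @ p --> p.2 by exact: cvg_snd.
have hc p : {for p, continuous (h \o fst : 'rV[R]_m * 'rV[R]_n -> R)}.
  have xc : (fun p' : 'rV[R]_m * 'rV[R]_n => p'.1 - x) @ p --> p.1 - x.
    by apply: cvgB; [exact: fstc|exact: cvg_cst].
  apply: cvgB; first by apply: cvgM; [exact: cvg_cst|exact: cvg_norm].
  by apply: cvg_dot => //; exact: cvg_cst.
have f0lsc p : lsc_at f0 p.
  apply: lsc_at_addr; last exact: hc.
  apply: (@lsc_at_comp _ _ _ g snd); first exact: sndc.
  exact: lower_semicontinuous_at.
have f0Ny p : (-oo < f0 p)%E.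
  by rewrite /f0 ltNye_eq; have := gp.2 p.2; case: (g p.2).
have qc p : K p -> {for p, continuous q}.
  move=> [/= /xr0[Vp _] _].
  have Fc : (fun p' => F p'.1 - p'.2) @ p --> F p.1 - p.2.
    apply: cvgB; last exact: sndc.
    exact: (continuous_cvg _ (differentiable_continuous (dF _ Vp)) (fstc p)).
  exact: cvg_dot.
pose a := fine (f x); have fxE : f x = a%:E by rewrite fineK.
pose U (p : 'rV[R]_m * 'rV[R]_n) := `|p.1 - x| < r /\ `|p.2 - F x| < r.
(* By compactness one [k] serves for all of [K] outside the open balls. *)
have far : \forall k \near +oo, K `<=` [set p | U p \/
    (a%:E < f0 p + (k * q p)%:E)%E].
  move/compact_near_coveringP : cK; apply => p Kp.
  have [[p1 p2]|Up] := pselect (U p).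
    have Unear : \forall p' \near p, U p'.
      by apply: filterI;
        [exact: (cvgr_lt _ (cvg_dist (fstc p)))|exact: (cvgr_lt _ (cvg_dist (sndc p)))].
    by near=> p' k => /=; left; near: p'.
  suff : \forall p' \near p & k \near +oo, (a%:E < f0 p' + (k * q p')%:E)%E.
    by apply: filterS => -[p' k] /=; right.
  apply: penalty_eventually_exceeds => //; first exact: qc.
    by move=> p'; exact: dot_ge0.
  move=> /dot_eq0/eqP; rewrite subr_eq0 => /eqP Fp.
  have [Vp px] := xr0 _ Kp.1.
  have p1x : 0 < `|p.1 - x|.
    rewrite normr_gt0 subr_eq0; apply/eqP => p1x; apply: Up.
    by rewrite /U -Fp p1x !subrr !normr0.
  rewrite /f0 -Fp -fg//.
  have : (a%:E < a%:E + (d / 2 * `|p.1 - x|)%:E)%E.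
    by rewrite -EFinD lte_fin ltrDl mulr_gt0.
  move=> /lt_le_trans; apply.
  have := leeD2r (h p.1)%:E px; apply: le_trans.
  rewrite fxE -!EFinD lee_fin /h; lra.
have [k kfar] := filter_ex far.
have Kx : K (x, F x) by split; rewrite /= subrr normr0 ltW.
have [[x1 z1] Kp pmin] : exists2 p, K p & forall p', K p' ->
    (f0 p + (k * q p)%:E <= f0 p' + (k * q p')%:E)%E.
  apply: lsc_compact_min => //; first by exists (x, F x).
    by move=> p _; rewrite ltNye_eq; have := f0Ny p; case: (f0 p).
  move=> p Kp; apply: lsc_at_addr => //.
  by apply: cvgM; [exact: cvg_cst|exact: qc].
have pa : (f0 (x1, z1) + (k * q (x1, z1))%:E <= a%:E)%E.
  apply: le_trans (pmin _ Kx) _.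
  rewrite /f0 /q /h /= -fg// fxE -!EFinD lee_fin !subrr normr0.
  by rewrite dot0r dot0l; lra.
have [[x1r z1r]|] := kfar _ Kp; last by rewrite ltNge pa.
have [Vx1 _] := xr0 _ (ltW x1r).
have gz1 : g z1 \is a fin_num.
  rewrite fin_real// gp.2/= ltey; apply: contraTneq pa => gz1.
  by rewrite /f0/= gz1 -ltNge !addye// ltry.
exists x1, z1, ((2 * k) *: (F x1 - z1)); split => //; try exact: lt_trans rd.
- apply: convex_subgradient_of_prox_min => //.
  have : \forall z' \near z1, `|z' - F x| < r.
    by exact: (cvgr_lt _ (cvg_dist (@cvg_id _ (nbhs z1)))).
  apply: filterS => z' /ltW z'r.
  have := pmin (x1, z') (conj (ltW x1r) z'r).
  by rewrite /f0 /q /= ![(_ + (h x1)%:E + _)%E]addeAC leeD2rE.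
- apply: (stationary_of_penalty_min (x := x)) => //; first exact: dF.
    exact: ltW.
  have : \forall x' \near x1, `|x' - x| < r.
    by exact: (cvgr_lt _ (cvg_dist (@cvg_id _ (nbhs x1)))).
  apply: filterS => x' /ltW x'r.
  have := pmin (x', z1) (conj x'r (ltW z1r)).
  by rewrite /f0 /q /= -!addeA leeD2lE// -!EFinD lee_fin.
Unshelve. all: by end_near. Qed.

End FuzzyChainRule.

(** * Bounded multipliers and the exact chain rule *)

Section MultiplierRule.
Context {R : realType} {m n : nat}.
Implicit Types (f : 'rV[R]_m -> \bar R) (g : 'rV[R]_n -> \bar R).
Implicit Types (F : 'rV[R]_m -> 'rV[R]_n) (V : set 'rV[R]_m).

Lemma fuzzy_chain_rule_limiting f g F V (x v : 'rV[R]_m)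
    (Q : set ('rV[R]_m * 'rV[R]_n * 'rV[R]_m)) :
  open V -> V x -> (forall x', V x' -> differentiable F x') ->
  Gamma0 g -> (forall x', V x' -> f x' = g (F x')) ->
  subdiff f x v -> nbhs (x, F x, v) Q ->
  exists x1 z1 y, [/\ V x1, convex_subgradient g z1 y &
    Q (x1, z1, y *m (jacobian F x1)^T)].
Proof.
move=> oV Vx dF gG fg [_ [xs [vs [xsx _ vsv vreg]]]].
move=> /nbhs_ballP[d /= d0 dQ]; have d20 : 0 < d / 2 by rewrite divr_gt0.
have Fc : F x' @[x' --> x] --> F x by exact/differentiable_continuous/dF.
have near_half m' (s : nat -> 'rV[R]_m') (s0 : 'rV[R]_m') : s @ \oo --> s0 ->
    \forall k \near \oo, `|s k - s0| < d / 2.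
  by move=> ss; apply: (cvgr_lt _ (cvg_dist ss)); rewrite subrr normr0.
have [k [[xk vk] [Fk Vk]]] : exists k, (`|xs k - x| < d / 2 /\
    `|vs k - v| < d / 2) /\ (`|F (xs k) - F x| < d / 2 /\ V (xs k)).
  apply: (@filter_ex _ \oo); apply: filterI; apply: filterI.
  - exact: near_half.
  - exact: near_half.
  - apply: (@near_half _ (F \o xs)).
    exact: (continuous_cvg _ Fc xsx).
  - by apply: xsx; exact: open_nbhs_nbhs.
have [x1 [z1 [y [x1k z1k Vx1 yz1 yv]]]] :=
  fuzzy_chain_rule oV Vk dF gG fg (vreg k) d20.
exists x1, z1, y; split=> //; apply: dQ.
have tri m' (a b c : 'rV[R]_m') : `|a - b| <= d / 2 -> `|b - c| < d / 2 ->
    ball c d a.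
  move=> ab bc; rewrite -ball_normE/= distrC -(subrKA b) (splitr d).
  by rewrite (le_lt_trans (ler_normD _ _))// ler_ltD.
split; first split => /=.
- exact: tri (ltW x1k) xk.
- exact: tri (ltW z1k) Fk.
- exact: tri yv vk.
Qed.

(** A subgradient of [g] with large norm is, after rescaling, almost normal to
the domain of [g]: evaluating the subgradient inequality at a fixed point of the
domain leaves nothing to balance a positive inner product.  The constraint
qualification excludes a unit normal annihilated by the adjoint Jacobian, and
compactness of the unit sphere makes this exclusion uniform. *)
Lemma multipliers_bounded g F (xbar : 'rV[R]_m) (B : R) :
  Gamma0 g -> edom g (F xbar) -> {for xbar, continuous (jacobian F)} ->
  (forall y, normal_cone (closure (edom g)) (F xbar) y ->
     y *m (jacobian F xbar)^T = 0 -> y = 0) ->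
  exists M, \forall t \near (xbar, F xbar), forall y,
    convex_subgradient g t.2 y -> `|y *m (jacobian F t.1)^T| <= B -> `|y| <= M.
Proof.
move=> [[_ gNy] glsc _] gF Jc cq.
pose S := [set u : 'rV[R]_n | `|u| = 1].
have cS : compact S.
  have -> : S = [set u : 'rV[R]_n | `|u - 0| <= 1] `&` S.
    by apply/seteqP; split=> [u Su|u []//]; split=> //=; rewrite subr0 Su.
  apply: compact_closedI; first exact: compact_sup_ball.
  have nc : continuous (fun u : 'rV[R]_n => `|u|) by exact: norm_continuous.
  by move/continuous_closedP : nc => /(_ _ (@closed_eq R 1)).
pose P (ts : ('rV[R]_m * 'rV[R]_n) * R) (u : 'rV[R]_n) :=
  ~ (convex_subgradient g ts.1.2 (ts.2 *: u) /\
     `|ts.2 *: u *m (jacobian F ts.1.1)^T| <= B).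
(* A multiplier is written [s *: u] with [u] on the unit sphere; its norm [s] is
   one of the parameters, tending to infinity. *)
pose I := filter_prod (nbhs (xbar, F xbar)) (pinfty_nbhs R).
have : \forall ts \near I, S `<=` P ts.
  move/compact_near_coveringP : cS => /(_ _ I P); apply => u Su.
  pose G := filter_prod (nbhs u) I.
  have Gu : p.1 @[p --> G] --> u by exact: cvg_fst.
  have GI : p.2 @[p --> G] --> I by exact: cvg_snd.
  have Gt : p.2.1 @[p --> G] --> (xbar, F xbar).
    exact: (cvg_comp _ _ GI cvg_fst).
  have Gx : p.2.1.1 @[p --> G] --> xbar by exact: (cvg_comp _ _ Gt cvg_fst).
  have Gz : p.2.1.2 @[p --> G] --> F xbar by exact: (cvg_comp _ _ Gt cvg_snd).
  have Gs : p.2.2 @[p --> G] --> +oo by exact: (cvg_comp _ _ GI cvg_snd).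
  suff : \forall p \near G, P p.2 p.1 by apply: filterS => -[].
  have [uJ|uJ] := eqVneq (u *m (jacobian F xbar)^T) 0.
    (* Otherwise [u] would be a normal to the closed domain, hence zero. *)
    have : exists2 z, edom g z & 0 < dot u (z - F xbar).
      apply: contrapT => noz.
      have u0 : u = 0.
        apply: cq uJ; split; first exact: subset_closure.
        exists (fun=> F xbar), (fun=> u); split; try exact: cvg_cst.
        move=> _; split=> [|e e0]; first exact: subset_closure.
        apply: (@filterE _ (nbhs (F xbar))) => w wD; rewrite (@le_trans _ _ 0)//.
          move: wD; rewrite closureEbigcap.
          move=> /(_ [set w | dot u (w - F xbar) <= 0]); apply; split.
            have dc : continuous (fun w : 'rV[R]_n => dot u (w - F xbar)).
              move=> w'.
              exact: (cvg_dot (cvg_cst u) (cvgB (@cvg_id _ (nbhs w')) (cvg_cst _))).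
            by move/continuous_closedP : dc => /(_ _ (@closed_le R 0)).
          move=> z gz /=; rewrite leNgt; apply/negP => uz.
          by apply: noz; exists z.
        by rewrite mulr_ge0 ?enorm_ge0// ltW.
      by move: Su; rewrite /S/= u0 normr0 => /eqP; rewrite eq_sym oner_eq0.
    move=> [z gz uz].
    have gzfin : g z \is a fin_num by rewrite fin_real// gNy.
    have [e /andP[_ eg]] := exists_fin_between (gNy (F xbar)) (gNy (F xbar)).
    pose c := dot u (z - F xbar) / 2; have c0 : 0 < c by rewrite divr_gt0.
    have near_c : \forall p \near G, c < dot p.1 (z - p.2.1.2).
      apply: (cvgr_gt _ (cvg_dot Gu (cvgB (cvg_cst z) Gz))).
      by rewrite /c; lra.
    have near_e : \forall p \near G, (e%:E < g p.2.1.2)%E.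
      exact: (Gz _ (lower_semicontinuous_at glsc eg)).
    have near_s : \forall p \near G, 0 < p.2.2 /\ (fine (g z) - e) / c < p.2.2.
      apply: filterI; first exact: (Gs _ (nbhs_pinfty_gt (num_real 0))).
      exact: (Gs _ (nbhs_pinfty_gt (num_real _))).
    apply: filterS3 near_c near_e near_s => -[u' [[x1 z1] s]] /= cu eg1 [s0 es].
    move=> [/(_ z) + _]; apply/negP; rewrite -ltNge.
    rewrite -(fineK gzfin) dotZl.
    apply: (@lt_trans _ _ (e%:E + (s * dot u' (z - z1))%:E)%E); last first.
      by rewrite lteD2rE.
    rewrite -EFinD lte_fin -ltrBlDl; apply: (@lt_trans _ _ (s * c)).
      by rewrite -ltr_pdivrMr.
    by rewrite ltr_pM2l.
  pose N := `|u *m (jacobian F xbar)^T|.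
  have N0 : 0 < N / 2 by rewrite divr_gt0 ?normr_gt0.
  have near_N : \forall p \near G, N / 2 < `|p.1 *m (jacobian F p.2.1.1)^T|.
    have cvgJ : jacobian F p.2.1.1 @[p --> G] --> jacobian F xbar.
      exact: (continuous_cvg _ Jc Gx).
    have cvgN : `|p.1 *m (jacobian F p.2.1.1)^T| @[p --> G] --> N.
      exact: (cvg_norm (cvg_mulmx_tr Gu cvgJ)).
    by apply: (cvgr_gt _ cvgN); lra.
  have near_s : \forall p \near G, 0 < p.2.2 /\ B / (N / 2) < p.2.2.
    apply: filterI; first exact: (Gs _ (nbhs_pinfty_gt (num_real 0))).
    exact: (Gs _ (nbhs_pinfty_gt (num_real _))).
  apply: filterS2 near_N near_s => -[u' [[x1 z1] s]] /= Nu [s0 Ns] [_].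
  apply/negP; rewrite -ltNge -scalemxAl normrZ (gtr0_norm s0).
  rewrite ltr_pdivrMr// in Ns; apply: (lt_trans Ns).
  by rewrite ltr_pM2l.
move=> [[A1 A2] [/= A1n [M0 [_ M0A]]] AS].
exists (Num.max M0 0); apply: filterS A1n => t A1t y yg yB.
rewrite leNgt; apply/negP; rewrite gt_max => /andP[M0y y0].
have := AS (t, `|y|) (conj A1t (M0A _ M0y)).
move=> /(_ (`|y|^-1 *: y)); rewrite /S/= normrZ normfV normr_id.
rewrite mulVf ?gt_eqF// => /(_ erefl); apply.
by rewrite /= scalerA mulfV ?gt_eqF// scale1r.
Qed.

(** The approximate multipliers stay in the compact ball of radius [M].  A point
[u] of that ball fails to be an exact multiplier either because [J(x)^* u != v],
or because some [z] violates the subgradient inequality at [F x].  Both failures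
persist for nearby data, the second by lower semicontinuity of [g]; if every
point failed, compactness would exclude approximate multipliers close to
[(x, F x, v)]. *)
Lemma limiting_chain_rule f g F V (x v : 'rV[R]_m) (M : R) :
  open V -> V x -> C1_on V F ->
  Gamma0 g -> (forall x', V x' -> f x' = g (F x')) ->
  (\forall t \near (x, F x, v), forall y,
     convex_subgradient g t.1.2 y -> y *m (jacobian F t.1.1)^T = t.2 ->
     `|y| <= M) ->
  subdiff f x v ->
  exists y, [/\ `|y| <= M, convex_subgradient g (F x) y &
    y *m (jacobian F x)^T = v].
Proof.
move=> oV Vx FC1 gG fg Mbd vf; apply: contrapT => noy.
have [[_ gNy] glsc _] := gG.
pose I := nbhs (x, F x, v).
pose P (t : 'rV[R]_m * 'rV[R]_n * 'rV[R]_m) (y : 'rV[R]_n) :=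
  ~ (convex_subgradient g t.1.2 y /\ y *m (jacobian F t.1.1)^T = t.2).
have : \forall t \near I, [set y | `|y - 0| <= M] `<=` P t.
  move/compact_near_coveringP : (@compact_sup_ball R n 0 M).
  move=> /(_ _ I P); apply => u /=; rewrite subr0 => uM.
  pose G := filter_prod (nbhs u) I.
  have Gu : p.1 @[p --> G] --> u by exact: cvg_fst.
  have GI : p.2 @[p --> G] --> (x, F x, v) by exact: cvg_snd.
  have Gt : p.2.1 @[p --> G] --> (x, F x) by exact: (cvg_comp _ _ GI cvg_fst).
  have Gv : p.2.2 @[p --> G] --> v by exact: (cvg_comp _ _ GI cvg_snd).
  have Gx : p.2.1.1 @[p --> G] --> x by exact: (cvg_comp _ _ Gt cvg_fst).
  have Gz : p.2.1.2 @[p --> G] --> F x by exact: (cvg_comp _ _ Gt cvg_snd).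
  suff : \forall p \near G, P p.2 p.1 by apply: filterS => -[].
  have [uJ|uJ] := eqVneq (u *m (jacobian F x)^T) v.
    have [z uz] : exists z, ~ (g (F x) + (dot u (z - F x))%:E <= g z)%E.
      by apply/existsNP => uz; apply: noy; exists u.
    move/negP : uz; rewrite -ltNge => uz.
    have dc : (fun p => dot p.1 (z - p.2.1.2)) @ G --> dot u (z - F x).
      exact: (cvg_dot Gu (cvgB (cvg_cst z) Gz)).
    have gzfin : g z \is a fin_num.
      by rewrite fin_real// gNy (lt_le_trans uz)// leey.
    move: uz; rewrite -(fineK gzfin) -lteBlDr// -EFinB => uz.
    have [e1 [e10 e1g]] : exists e1, 0 < e1 /\
        ((fine (g z) - dot u (z - F x) + e1)%:E < g (F x))%E.
      case: (g (F x)) uz => [b|_|//]; last by exists 1; rewrite ltry.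
      rewrite lte_fin => zb; exists ((b - (fine (g z) - dot u (z - F x))) / 2).
      by rewrite lte_fin; split; lra.
    have near_e : \forall p \near G,
        ((fine (g z) - dot u (z - F x) + e1)%:E < g p.2.1.2)%E.
      exact: (Gz _ (lower_semicontinuous_at glsc e1g)).
    have near_d : \forall p \near G,
        dot u (z - F x) - e1 < dot p.1 (z - p.2.1.2).
      by apply: (cvgr_gt _ dc); rewrite ltrBlDr ltrDl.
    apply: filterS2 near_e near_d => -[u' [[x1 z1] v1]] /= eg1 du [/(_ z) + _].
    apply/negP; rewrite -ltNge -(fineK gzfin).
    apply: lt_le_trans (leeD2r _ (ltW eg1)).
    by rewrite -EFinD lte_fin; lra.
  have Jc : jacobian F p.2.1.1 @[p --> G] --> jacobian F x.
    exact: (continuous_cvg _ (FC1 _ Vx).2 Gx).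
  have cvgd : `|p.1 *m (jacobian F p.2.1.1)^T - p.2.2| @[p --> G] -->
      `|u *m (jacobian F x)^T - v|.
    exact: (cvg_norm (cvgB (cvg_mulmx_tr Gu Jc) Gv)).
  have : \forall p \near G, 0 < `|p.1 *m (jacobian F p.2.1.1)^T - p.2.2|.
    by apply: (cvgr_gt _ cvgd); rewrite normr_gt0 subr_eq0.
  apply: filterS => -[u' [[x1 z1] v1]] /=; rewrite normr_gt0 subr_eq0 => /eqP.
  by move=> ne [].
move=> /(filterI Mbd) Inear.
have [x1 [z1 [y [Vx1 yg [yM noP]]]]] :=
  fuzzy_chain_rule_limiting oV Vx (fun x' Vx' => (FC1 _ Vx').1) gG fg vf Inear.
by apply: (noP y); rewrite /= ?subr0; [exact: yM|split].
Qed.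

End MultiplierRule.

(** * Linearization error under smooth adaptability *)

Section RelativeSmoothness.
Context {R : realType} {m : nat}.
Implicit Types (phi : 'rV[R]_m -> \bar R) (V : set 'rV[R]_m).

Lemma convex_set_ball (c : 'rV[R]_m) (r : R) :
  convex_set [set x : 'rV[R]_m | `|x - c| < r].
Proof.
apply/convex_setW => x y; rewrite !inE /= => xr yr k k0 k1.
rewrite inE /=; set t := k%:num in k0 k1 *.
have -> : conv k x y - c = t *: (x - c) + (1 - t) *: (y - c).
  rewrite !scalerBr addrACA -opprD -scalerDl addrC.
  by rewrite (addrC t) subrK scale1r addrC.
apply: le_lt_trans (ler_normD _ _) _; rewrite !normrZ.
by rewrite (gtr0_norm k0) gtr0_norm ?subr_gt0//; nra.
Qed.

Lemma convex_function_tangent (C : set 'rV[R]_m) (h : 'rV[R]_m -> R^o)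
    (x x' : 'rV[R]_m) (D : R) :
  convex_function C h -> C x -> C x' -> is_derive x (x' - x) h D ->
  h x + D <= h x'.
Proof.
move=> hconv Cx Cx' [hdiff hD].
have qD : (t^-1 * (h (t *: (x' - x) + x) - h x) : R) @[t --> 0^'+] --> D.
  by rewrite -hD; exact: cvg_dnbhs_at_right hdiff.
rewrite addrC -lerBrDr; apply: (cvgr_to_le qD).
near=> t.
have t0 : 0 < t by near: t; exact: nbhs_right_gt.
have t1 : t < 1 by near: t; exact: nbhs_right_lt.
have := hconv (Itv01 (ltW t0) (ltW t1)) x' x (mem_set Cx') (mem_set Cx).
have -> : conv (Itv01 (ltW t0) (ltW t1))
    (x' : convex_lmodType 'rV[R]_m) (x : convex_lmodType 'rV[R]_m) = t *: (x' - x) + x.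
  rewrite /conv/= scalerBr scalerBl scale1r.
  by rewrite [LHS]addrA [RHS]addrAC.
move=> ht; have {}ht : (h (t *: (x' - x) + x) : R) <= t * h x' + (1 - t) * h x.
  exact: ht.
by rewrite ler_pdivrMl//; lra.
Unshelve. all: by end_near. Qed.

Lemma dot_grad phi x w : differentiable (fine \o phi : 'rV[R]_m -> R^o) x ->
  dot (grad phi x) w = 'D_w (fine \o phi : 'rV[R]_m -> R^o) x.
Proof.
move=> dphi; rewrite deriveE// [in RHS](row_sum_delta w) linear_sum.
by apply: eq_bigr => i _; rewrite mxE deriveE// linearZ mulrC.
Qed.

Lemma bregmanE phi x x' : (forall z, (-oo < phi z)%E) -> (edom phi)° x ->
  edom phi x' ->
  bregman phi x' x =
  (fine (phi x') - fine (phi x) - dot (grad phi x) (x' - x))%:E.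
Proof.
move=> phiNy ix domx'; rewrite /bregman asboolT//.
have fx : phi x \is a fin_num.
  by rewrite fin_real// phiNy; exact: (interior_subset ix).
have fx' : phi x' \is a fin_num by rewrite fin_real// phiNy.
by rewrite -(fineK fx) -(fineK fx') /= -!EFinB.
Qed.

(** Convexity of [L phi - h] and of [L phi + h] says that each lies above its
tangent at [x]; together these two bounds control the linearization error of
[h] from both sides. *)
Lemma smooth_adaptable_linearization phi V (C : set 'rV[R]_m) (L : R)
    (h : 'rV[R]_m -> R) (x x' : 'rV[R]_m) :
  smooth_adaptable L phi V h -> convex_set C -> C `<=` V -> C x -> C x' ->
  differentiable (fine \o phi : 'rV[R]_m -> R^o) x ->
  derivable (h : 'rV[R]_m -> R^o) x (x' - x) ->
  `|h x' - h x - 'D_(x' - x) (h : 'rV[R]_m -> R^o) x| <=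
  L * (fine (phi x') - fine (phi x) - dot (grad phi x) (x' - x)).
Proof.
move=> [subc addc] Cc CV Cx Cx' dphi dh.
rewrite dot_grad//.
have dphi' := derivableP (@diff_derivable _ _ _ _ _ (x' - x) dphi).
have dh' := derivableP dh.
have tsub := convex_function_tangent (subc _ Cc CV) Cx Cx'
  (is_deriveB (is_deriveZ L dphi') dh').
have tadd := convex_function_tangent (addc _ Cc CV) Cx Cx'
  (is_deriveD (is_deriveZ L dphi') dh').
move: tsub tadd; rewrite /GRing.scale/= => tsub tadd.
by rewrite ler_norml; apply/andP; split; lra.
Qed.

End RelativeSmoothness.

(** * Prox-regularity of relatively amenable functions *)

Lemma locally_lsc_comp {R : realType} m n (f : 'rV[R]_m -> \bar R)
    (F : 'rV[R]_m -> 'rV[R]_n) (g : 'rV[R]_n -> \bar R) (V : set 'rV[R]_m)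
    (xbar : 'rV[R]_m) :
  open V -> V xbar -> (forall x, V x -> {for x, continuous F}) ->
  lower_semicontinuous g -> (forall x, V x -> f x = g (F x)) ->
  locally_lsc f xbar.
Proof.
move=> oV Vx Fc glsc fg.
have /nbhs_ballP[e0 /= e00 xV] : nbhs xbar V by exact: open_nbhs_nbhs.
exists (e0 / 2); first by rewrite divr_gt0.
move=> alpha _ p clp.
have pe : enorm (p - xbar) <= e0 / 2.
  rewrite leNgt; apply/negP => ep.
  have ec : enorm (q - xbar) @[q --> p] --> enorm (p - xbar).
    exact: (cvg_enorm (cvgB (@cvg_id _ (nbhs p)) (cvg_cst xbar))).
  have [q [[qe _]]] := clp _ (cvgr_gt _ ec _ ep).
  by rewrite /= ltNge qe.
have Vp : V p.
  apply: xV; rewrite -ball_normE/= distrC.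
  by rewrite (le_lt_trans (norm_le_enorm _))// (le_lt_trans pe)//; lra.
split=> //; rewrite leNgt; apply/negP; rewrite fg// => ap.
have near_p : \forall q \near p, V q /\ (alpha%:E < g (F q))%E.
  apply: filterI; first exact: open_nbhs_nbhs.
  exact: (Fc _ Vp _ (lower_semicontinuous_at glsc ap)).
have [q [[_ qa] [Vq aq]]] := clp _ near_p.
by move: qa; rewrite fg// leNgt aq.
Qed.

Theorem proposition3p28 (R : realType) (m : nat)
    (phi f : 'rV[R]_m -> \bar R) (xbar : 'rV[R]_m)
    (phiG : Gamma0 phi) (phiL : legendre phi)
    (xbar_int : (edom phi)° xbar)
    (famen : relatively_amenable phi f xbar) :
  prox_regular phi f xbar.
Proof.
have [[_ phiNy] _ _] := phiG; have [[_ dphi _] _] := phiL.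
have [fxfin [n [V [F [g [[[oV Vxbar] FC1 gG fg cq] Vdom [L L0 Fadapt]]]]]]] :=
  famen.
have dF x : V x -> differentiable F x by move=> /FC1[].
have Fc x : V x -> {for x, continuous F}.
  by move=> /dF; exact: differentiable_continuous.
have [[_ gNy] glsc _] := gG.
have gFxbar : edom g (F xbar) by rewrite /edom/= -fg// ltey_eq fxfin.
move=> vbar vbarf; split=> //; first exact: locally_lsc_comp oV Vxbar Fc glsc fg.
have [M Mbd] := multipliers_bounded (`|vbar| + 1) gG gFxbar (FC1 _ Vxbar).2 cq.
have Fpair x : V x -> (x', F x') @[x' --> x] --> (x, F x).
  by move=> Vx; exact: (cvg_pair (@cvg_id _ (nbhs x)) (Fc _ Vx)).
have : \forall x \near xbar, V x /\ \forall t \near (x, F x), forall y,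
    convex_subgradient g t.2 y ->
    `|y *m (jacobian F t.1)^T| <= `|vbar| + 1 -> `|y| <= M.
  apply: filterI; first exact: open_nbhs_nbhs.
  exact: (Fpair _ Vxbar _ (nbhs_interior Mbd)).
move=> /nbhs_ballP[e0 /= e00 xe0].
pose e := Num.min e0 1.
have e_gt0 : 0 < e by rewrite lt_min e00 ltr01.
pose C := [set x : 'rV[R]_m | `|x - xbar| < e].
have CP x : enorm (x - xbar) < e -> C x.
  by move=> xe; rewrite /C/= (le_lt_trans (norm_le_enorm _)).
have {}xe0 x : C x -> V x /\ \forall t \near (x, F x), forall y,
    convex_subgradient g t.2 y ->
    `|y *m (jacobian F t.1)^T| <= `|vbar| + 1 -> `|y| <= M.
  move=> xe; apply: xe0; rewrite -ball_normE/= distrC.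
  by rewrite (lt_le_trans xe)// ge_min lexx.
have CV : C `<=` V by move=> x /xe0[].
exists e, (L * `|M| *+ n); split=> //.
- by rewrite mulrn_wge0// mulr_ge0.
- by move=> x /CP/CV/Vdom.
move=> x' x v /CP Cx' /CP Cx _ vf /(le_lt_trans (norm_le_enorm _)) vv.
have [Vx Mx] := xe0 _ Cx.
have [y [yM yg yv]] : exists y, [/\ `|y| <= M, convex_subgradient g (F x) y &
    y *m (jacobian F x)^T = v].
  apply: (limiting_chain_rule oV Vx FC1 gG fg) vf.
  have Mxv : \forall t \near (x, F x, v), forall y,
      convex_subgradient g t.1.2 y ->
      `|y *m (jacobian F t.1.1)^T| <= `|vbar| + 1 -> `|y| <= M.
    exact: cvg_fst Mx.
  have near_v : \forall t \near (x, F x, v), `|t.2 - vbar| < e.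
    have tv : t.2 @[t --> (x, F x, v)] --> v by exact: cvg_snd.
    exact: (cvgr_lt _ (cvg_dist tv) _ vv).
  apply: filterS2 Mxv near_v => t tM tv y yg yJ; apply: tM => //.
  rewrite yJ -(subrK vbar t.2) addrC (le_trans (ler_normD _ _))// lerD2l.
  by rewrite (le_trans (ltW tv))// ge_min lexx orbT.
have gFx : g (F x) \is a fin_num by rewrite -fg//; case: vf.
pose w := x' - x.
pose D := fine (phi x') - fine (phi x) - dot (grad phi x) w.
have err i : `|F x' 0 i - F x 0 i - (w *m jacobian F x) 0 i| <= L * D.
  have dFx : derivable F x w by exact/diff_derivable/dF.
  have -> : (w *m jacobian F x) 0 i = 'D_w (fun z => F z 0 i : R^o) x.
    by rewrite -deriveEjacobian ?derive_mx ?mxE//; exact: dF.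
  have dFi : derivable (fun z => F z 0 i : R^o) x w.
    exact: ((derivable_mxP _ _ _).1 dFx).
  exact: (smooth_adaptable_linearization (Fadapt i) (@convex_set_ball _ _ xbar e)
    CV Cx Cx' (dphi _ (Vdom _ Vx)) dFi).
rewrite bregmanE//; [|exact: Vdom|exact: interior_subset (Vdom _ (CV _ Cx'))].
rewrite (fg _ Vx) (fg _ (CV _ Cx')); apply: le_trans (yg (F x')).
rewrite -(fineK gFx) -!EFinD lee_fin -/w -/D -addrA lerD2l -yv dot_mulmx_tr.
rewrite lerBlDr -lerBlDl -dotBr.
set E := w *m _ - _.
(* [E] is minus the linearization error of [F]; summing the [n] coordinatewise
   bounds produces the factor [n] in the constant. *)
have Ei i : y 0 i * E 0 i <= `|M| * (L * D).
  rewrite (le_trans (ler_norm _))// normrM ler_pM//.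
    exact: le_trans (coord_le_norm _ _) (le_trans yM (ler_norm _)).
  apply: le_trans (err i).
  by rewrite /E !mxE distrC.
rewrite (le_trans (ler_sum _ (fun i _ => Ei i)))// sumr_const card_ord.
by rewrite mulrnAl mulrCA mulrA.
Qed.
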